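(* Let $\Gamma$ be a class of topological spaces, let $D$ be a finite set of cardinality at least two, and assume $\mathtt{OGD}^{D}(\Gamma)$. Suppose that $X$ is a Hausdorff space in $\Gamma$ and $H$ is an open $D$-dimensional dihypergraph on $X$. Then either $\chi(H)\le\aleph_0$ or $\chi(H)\ge\mathfrak{b}$.
   Context: Working in $\mathsf{ZFC}$. A $D$-dimensional dihypergraph on $X$ is a subset $H$ of $X^D$ containing no constant sequence; open means open in $X^D$ (the box and product topologies coincide as $D$ is finite). The chromatic number $\chi(H)$ is the least cardinal $\kappa$ for which there is a map from $X$ to a set of cardinality $\kappa$ that is non-constant along every element of $H$. A homomorphism from $R\subseteq W^{D}$ to $S\subseteq Z^{D}$ is a map $W\to Z$ sending, coordinatewise, elements of $R$ to elements of $S$. $\mathbb{H}_{D^{\mathbb{N}}}=\bigcup_{t\in D^{<\mathbb{N}}}\prod_{d\in D}\mathcal{N}_{t\cdot(d)}$ is a $D$-dimensional dihypergraph on $D^{\mathbb{N}}$ (product topology, $D$ discrete), where $D^{<\mathbb N}$ is the set of finite sequences from $D$, $\mathcal{N}_s=\{b\in D^{\mathbb{N}} : s\sqsubseteq b\}$, and $t\cdot(d)$ is $t$ followed by the single entry $d$. $\mathtt{OGD}^{D}(\Gamma)$ is the statement: for every $Z\in\Gamma$ and every box-open $D$-dimensional dihypergraph $G$ on $Z$ (open in the box topology on $Z^D$), either $\chi(G)\le\aleph_0$ or there is a continuous homomorphism from $\mathbb{H}_{D^{\mathbb{N}}}$ to $G$. $\mathfrak{b}$ is the bounding number: the least cardinality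 of a set $\mathcal{F}\subseteq\mathbb{N}^{\mathbb{N}}$ such that for every $c\in\mathbb{N}^{\mathbb{N}}$ there is $d\in\mathcal{F}$ for which it is not the case that $d(n)\le c(n)$ for all but finitely many $n$. *)

(* Defs.v *)
From mathcomp Require Import all_boot all_order.
From mathcomp Require Import all_classical topology.

Set Implicit Arguments.
Unset Strict Implicit.
Unset Printing Implicit Defensive.

Local Open Scope classical_set_scope.
Local Open Scope card_scope.

(* Cardinals are represented by sets and compared with [#<=]; [least_card P]
   is a member of [P] of least cardinality, when [P] is nonempty. *)
Definition has_least_card T (P : set (set T)) (A : set T) : Prop :=
  P A /\ forall B, P B -> A #<= B.

Definition least_card T (P : set (set T)) : set T := get (has_least_card P).

Lemma least_cardP T (P : set (set T)) :
  P !=set0 -> has_least_card P (least_card P).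
Proof.
move=> [A0 PA0]; apply: getPex.
pose Q (S : set (set T -> T)) :=
  (forall f A, S f -> P A -> A (f A)) /\
  (forall f g A, S f -> S g -> P A -> f A = g A -> f = g).
have [F FQ totF|S [[S1 S2] Smax]] := @Zorn_bigcup _ Q.
  split=> [f A [X FX Xf]|f g A [X FX Xf] [Y FY Yg]].
    by have [+ _] := FQ _ FX; apply.
  by have [XY|YX] := totF _ _ FX FY; [have [_] := FQ _ FY | have [_] := FQ _ FX];
    apply => //; [exact: XY|exact: YX].
have [[A [PA AS]]|noA] :=
  pselect (exists A, P A /\ A `<=` [set f A | f in S]).
  exists A; split=> // B PB.
  apply: card_le_trans (subset_card_le AS) _.
  apply: card_le_trans (card_image_le _ _) _.
  have injB : {in S &, injective (fun f => f B)}.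
    by move=> f g /set_mem Sf /set_mem Sg; exact: S2.
  have /card_eqPle[_ SB] := inj_card_eq injB.
  apply: card_le_trans SB _; apply: subset_card_le => _ [f Sf <-].
  exact: (S1 f B).
have pickA A : P A -> exists t, A t /\ ~ [set f A | f in S] t.
  move=> PA; apply: contrapT => h; apply: noA; exists A; split=> // t At.
  by apply: contrapT => nt; apply: h; exists t.
have [t0 _] := pickA _ PA0.
have /choice[a aP] A : exists t, P A -> A t /\ ~ [set f A | f in S] t.
  have [PA|nPA] := pselect (P A); last by exists t0.
  by have [t tP] := pickA _ PA; exists t.
have Q' : Q (S `|` [set a]).
  split=> [f A [Sf|->] PA|f g A [Sf|->] [Sg|->] PA].
  - exact: (S1 f A).
  - by have [] := aP _ PA.
  - exact: (S2 f g A).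
  - by move=> e; have [_] := aP _ PA; case; exists f.
  - by move=> e; have [_] := aP _ PA; case; exists g.
  - by [].
exfalso; apply: Smax Q'; split=> [|/(_ a (or_intror erefl)) Sa].
  exact: subsetUl.
by have [_] := aP _ PA0; case; exists a.
Qed.

Section dihypergraphs.
Variable D : finType.

Definition constant_seq T (x : D -> T) : Prop := exists z, forall d, x d = z.

Definition dihypergraph X (H : set (D -> X)) : Prop :=
  forall x, H x -> ~ constant_seq x.

Definition coloring X U (H : set (D -> X)) (L : set U) (c : X -> U) : Prop :=
  (forall x, L (c x)) /\ forall x, H x -> ~ constant_seq (c \o x).

Definition colorable X U (H : set (D -> X)) (L : set U) : Prop :=
  exists c : X -> U, coloring H L c.

(* Identifying each color with a point that bears it, the colors of an optimal
   coloring can be taken in X; [chromatic_le] shows that nothing is lost. *)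
Definition chromatic X (H : set (D -> X)) : set X :=
  least_card [set L : set X | colorable H L].

Lemma chromatic_colorable X (H : set (D -> X)) :
  dihypergraph H -> colorable H (chromatic H).
Proof.
move=> Hd; suff /least_cardP[] : [set L : set X | colorable H L] !=set0 by [].
by exists setT, id; split.
Qed.

Lemma chromatic_le X (H : set (D -> X)) U (L : set U) :
  colorable H L -> chromatic H #<= L.
Proof.
move=> [c [cL cH]].
pose I := {u : U | exists y, c y = u}.
have /choice[r rP] (u : I) : exists x, c x = sval u.
  by case: u => u [y yu]; exists y.
pose i x : I := exist _ (c x) (ex_intro _ x erefl).
have crE x : c (r (i x)) = c x by rewrite rP.
have H0 : colorable H (range (r \o i)).
  exists (r \o i); split=> [x|x Hx [z zP]]; first by exists x.
  by apply: (cH x Hx); exists (c z) => d /=; rewrite -(zP d) /= crE.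
have [_ le] : has_least_card [set L : set X | colorable H L] (chromatic H).
  by apply: least_cardP; exists (range (r \o i)).
apply: card_le_trans (le _ H0) _.
have injc : {in range (r \o i) &, injective c}.
  move=> _ _ /set_mem[x _ <-] /set_mem[y _ <-] /=; rewrite !crE => e.
  by congr r; apply: eq_exist.
have /card_eqPle[_ cr] := inj_card_eq injc.
apply: card_le_trans cr _; apply: subset_card_le => _ [y _ <-]; exact: cL.
Qed.

(* Box topology on X^D: no finiteness of the set of restricted coordinates. *)
Definition box_open (X : topologicalType) (G : set (D -> X)) : Prop :=
  forall x, G x -> exists U : D -> set X,
    (forall d, open (U d) /\ U d (x d)) /\
    [set y : D -> X | forall d, U d (y d)] `<=` G.

Definition homomorphism W Z (R : set (D -> W)) (S : set (D -> Z))
    (phi : W -> Z) : Prop :=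
  forall x, R x -> S (phi \o x).

Definition branches : topologicalType :=
  {ptws nat -> discrete_topology D}.

(* [N_ s]: the branches extending the finite sequence [s]. *)
Definition cylinder (s : seq D) : set branches :=
  [set b | mkseq b (size s) = s].

Definition H_branches : set (D -> branches) :=
  \bigcup_(t in [set: seq D]) [set x | forall d, cylinder (rcons t d) (x d)].

Definition OGD (Gamma : topologicalType -> Prop) : Prop :=
  forall Z : topologicalType, Gamma Z ->
  forall G : set (D -> Z), dihypergraph G -> box_open G ->
    chromatic G #<= [set: nat] \/
    exists phi : branches -> Z,
      continuous phi /\ homomorphism H_branches G phi.

End dihypergraphs.

Definition unbounded (F : set (nat -> nat)) : Prop :=
  forall c : nat -> nat, exists2 d, F d &
    ~ (\forall n \near \oo, (d n <= c n)%N).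

Definition bounding : set (nat -> nat) := least_card unbounded.

Lemma bounding_least : has_least_card unbounded bounding.
Proof.
apply: least_cardP; exists setT => c; exists (fun n => (c n).+1) => //.
by move=> [N _ /(_ N (leqnn N))] /=; rewrite ltnn.
Qed.

(* Main.v *)
(* A colour class of H pulls back to a set of branches which, below every
   finite sequence t, avoids some t.d: each colour u yields a predictor
   [pi u] guessing a digit pi u (b|n) that a branch b of that colour never
   takes at n.  It therefore suffices to find, for fewer than b predictors, a
   single branch which every predictor guesses correctly somewhere.  This goes by
   induction on the alphabet a :: A: the branch is a^n0 y0 a^n1 y1 ... with yj
   in A.  When nj is large, either the predictor guesses a somewhere in
   the block a^nj, or its guess right after that block lies in A, so that one is
   left with predictors on the alphabet A.  As there are fewer than b
   predictors, the lengths nj can be chosen eventually large enough for all of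
   them at once. *)
Require Import Defs.
From mathcomp Require Import all_boot all_order.
From mathcomp Require Import all_classical topology.

Local Open Scope classical_set_scope.
Local Open Scope card_scope.

(** The supersets of open boxes around [x] form a filter that converges to [x] in every coordinate,
    hence in the product topology. *)
Lemma ptws_open_box_open (D : finType) (X : topologicalType)
    (H : set {ptws D -> X}) : open H -> @box_open D X H.
Proof.
move=> Ho x Hx.
pose F : set_system {ptws D -> X} := [set S | exists U : D -> set X,
  (forall d, open (U d) /\ U d (x d)) /\ [set y | forall d, U d (y d)] `<=` S].
have FF : Filter F.
  split.
  - by exists (fun=> setT); split=> // d; split=> //; exact: openT.
  - move=> P Q [U [Ux UP]] [V [Vx VQ]]; exists (fun d => U d `&` V d); split.
      move=> d; have [Uo Ud] := Ux d; have [Vo Vd] := Vx d.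
      by split=> //; exact: openI.
    by move=> y yUV; split; [apply: UP|apply: VQ] => d; have [] := yUV d.
  - move=> P Q PQ [U [Ux UP]]; exists U; split=> //.
    exact: subset_trans UP PQ.
suff Fx : F --> (x : {ptws D -> X}) by apply: Fx; exact: open_nbhs_nbhs.
apply/cvg_sup => d; apply/cvg_image.
  by apply/seteqP; split=> // z _; exists (fun=> z).
move=> V; rewrite nbhsE => -[W [Wo Wx] WV].
exists [set y : {ptws D -> X} | V (y d)].
  exists (fun e => if e == d then W else setT); split=> [e|y /(_ d)].
    by case: eqVneq => [->|_]; split=> //; exact: openT.
  by rewrite eqxx => /WV.
apply/seteqP; split=> [_ [y Vy <-]//|z Vz].
by exists (fun=> z).
Qed.

(** The functions [g i] with [i] in [L] form a family no larger than [L], too small to be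
    unbounded. *)
Lemma dominating_of_small I (L : set I) (g : I -> nat -> nat) :
  ~ (bounding #<= L) ->
  exists c : nat -> nat, forall i, L i ->
    exists N, forall n, (N <= n)%N -> (g i n <= c n)%N.
Proof.
move=> smallL; apply: contrapT => noc; apply: smallL.
have [_ bmin] := bounding_least.
apply: card_le_trans (card_image_le g L); apply: bmin => c.
apply: contrapT => nod; apply: noc; exists c => i Li.
have [N _ NP] : \forall n \near \oo, (g i n <= c n)%N.
  by apply: contrapT => nle; apply: nod; exists (g i) => //; exists i.
by exists N.
Qed.

Section interleaving.
Context {T : Type} (a : T) (c : nat -> nat).

(** Block lengths are read off at positions, not at indices [j]: the length needed is a maximum over
    all words that can precede the block, and these have length [block_start j]. *)
Fixpoint block_start j : nat :=
  if j is i.+1 then (block_start i + c (block_start i)).+1 else 0.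

Definition block_end j : nat := block_start j + c (block_start j).

(* The sequence a^n0 y0 a^n1 y1 ..., where nj = c (block_start j) and yj is at
   position [block_end j]; elsewhere [index] overflows and [nth] returns a. *)
Definition interleave (y : nat -> T) (k : nat) : T :=
  nth a (mkseq y k.+1) (index k (mkseq block_end k.+1)).

Lemma block_end_start i j : (i < j)%N -> (block_end i < block_start j)%N.
Proof.
elim: j => // j IH; rewrite ltnS leq_eqVlt => /orP[/eqP ->|/IH ij] //=.
exact: leq_trans ij (leqW (leq_addr _ _)).
Qed.

Lemma block_end_mono : {mono block_end : i j / (i <= j)%N}.
Proof.
apply: leq_mono => i j /block_end_start ij.
exact: leq_trans ij (leq_addr _ _).
Qed.

Lemma leq_block_start j : (j <= block_start j)%N.
Proof. by elim: j => //= j IH; rewrite ltnS (leq_trans IH) ?leq_addr. Qed.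

Lemma interleave_end y j : interleave y (block_end j) = y j.
Proof.
have jlt : (j < (block_end j).+1)%N.
  by rewrite ltnS (leq_trans (leq_block_start j)) ?leq_addr.
rewrite /interleave -{2}(nth_mkseq 0 block_end jlt) index_uniq ?nth_mkseq //.
  by rewrite size_mkseq.
exact/mkseq_uniq/incn_inj/block_end_mono.
Qed.

Lemma interleave_nend y k : (forall j, k <> block_end j) -> interleave y k = a.
Proof.
move=> kN; rewrite /interleave memNindex ?nth_default ?size_mkseq //.
by apply/mapP => -[j _ /kN].
Qed.

(** This makes the predictors on the smaller alphabet well defined from finite words of [y]. *)
Lemma interleave_prefix y z j : (forall i, (i < j)%N -> y i = z i) ->
  mkseq (interleave y) (block_start j) = mkseq (interleave z) (block_start j).
Proof.
move=> yz; apply/eq_in_map => k; rewrite mem_iota /= add0n => kj.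
have [[i ki]|kN] := pselect (exists i, k = block_end i); last first.
  by rewrite !interleave_nend // => i ki; apply: kN; exists i.
rewrite ki !interleave_end; apply: yz; rewrite ltnNge; apply/negP => ji.
move: kj; rewrite ki ltnNge => /negP; apply.
apply: leq_trans (leq_addr (c (block_start j)) _) _.
by rewrite block_end_mono.
Qed.

Lemma interleave_gap y j n : (n < c (block_start j))%N ->
  interleave y (block_start j + n) = a.
Proof.
move=> nc; apply: interleave_nend => i e.
have [ij|ji] := ltnP i j.
  by have := block_end_start _ _ ij; rewrite -e ltnNge leq_addr.
have : (block_end i < block_end j)%N by rewrite -e ltn_add2l.
by rewrite ltnNge block_end_mono ji.
Qed.

Lemma interleave_block y j n : (n <= c (block_start j))%N ->
  mkseq (interleave y) (block_start j + n)
    = mkseq (interleave y) (block_start j) ++ nseq n a.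
Proof.
elim: n => [|n IH] nc; first by rewrite addn0 cats0.
rewrite addnS mkseqS IH ?(ltnW nc) // interleave_gap // -cats1 -catA.
by rewrite -[[:: a]]/(nseq 1 a) -nseqD addn1.
Qed.

End interleaving.

(** Correct guesses at arbitrarily late positions are what the induction needs: [c] dominates [g i]
    only from some [N] on, depending on [i]. *)
Lemma evade_predictors (D : finType) I (L : set I) (A : seq D)
    (pi : I -> seq D -> D) :
  ~ (bounding #<= L) -> A != [::] -> (forall i t, pi i t \in A) ->
  exists x : nat -> D, (forall n, x n \in A) /\
    forall i, L i -> forall m, exists2 j, (m <= j)%N & x j = pi i (mkseq x j).
Proof.
move=> smallL; elim: A pi => // a [_ pi _ piA|a1 A IH pi _ piA].
  exists (fun=> a); split=> [n|i _ m]; first exact: mem_head.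
  by exists m => //; have := piA i (mkseq (fun=> a) m); rewrite inE => /eqP.
set A' := a1 :: A in IH piA.
have /choice[B BP] (u : I * seq D) : exists n,
    (exists k, pi u.1 (u.2 ++ nseq k a) = a) -> pi u.1 (u.2 ++ nseq n a) = a.
  have [[k kP]|nk] := pselect (exists k, pi u.1 (u.2 ++ nseq k a) = a).
    by exists k.
  by exists 0.
(* Finiteness of [D] bounds [B] on words of length [m]; the successor will put position
   [l + B (i, s)] strictly inside the block. *)
pose g i m := \max_(t : m.-tuple D) (B (i, tval t)).+1.
have [c cP] := dominating_of_small _ _ g smallL.
pose guess i (t : seq D) j :=
  pi i (mkseq (interleave a c (nth a t)) (block_start c j)
          ++ nseq (c (block_start c j)) a).
(* The fallback [a1] only keeps values in [A']: a guess other than [a] is already there. *)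
pose pi' i t := let d := guess i t (size t) in if d \in A' then d else a1.
have [||y [yA yP]] := IH pi'; first by [].
  by move=> i t; rewrite /pi' /=; case: ifP => // _; exact: mem_head.
pose x := interleave a c y.
have xA n : x n \in a :: A'.
  have [[j ->]|nN] := pselect (exists j, n = block_end c j).
    by rewrite /x interleave_end in_cons yA orbT.
  rewrite /x interleave_nend ?mem_head // => j nj; apply: nN; by exists j.
exists x; split=> // i Li m.
have [N NP] := cP i Li.
have [j jm yj] := yP i Li (maxn m N).
move: jm; rewrite geq_max => /andP[mj Nj].
set l := block_start c j; set s := mkseq x l.
have jl : (j <= l)%N := leq_block_start c j.
have guessE : guess i (mkseq y j) j = pi i (s ++ nseq (c l) a).
  rewrite /guess; congr (pi i (_ ++ _)).
  by apply: interleave_prefix => k kj; rewrite nth_mkseq.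
have [ka|nka] := pselect (exists k, pi i (s ++ nseq k a) = a).
  have Bc : (B (i, s) < c l)%N.
    apply: leq_trans (NP l (leq_trans Nj jl)).
    have sz : size s == l by rewrite size_mkseq.
    exact: (leq_bigmax (Tuple sz)).
  exists (l + B (i, s)); first by rewrite (leq_trans mj) // (leq_trans jl) ?leq_addr.
  rewrite /x interleave_gap // interleave_block ?(ltnW Bc) //.
  by rewrite (BP (i, s) ka).
exists (l + c l); first by rewrite (leq_trans mj) // (leq_trans jl) ?leq_addr.
rewrite {2}/x interleave_block // [LHS]interleave_end yj /pi' size_mkseq guessE.
have := piA i (s ++ nseq (c l) a); rewrite in_cons => /orP[/eqP e|->//].
by case: nka; exists (c l).
Qed.

Lemma bounding_le_H_branches_coloring (D : finType) U (L : set U) :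
  (0 < #|D|)%N -> colorable (@H_branches D) L -> bounding #<= L.
Proof.
move=> D0 [c [cL cH]]; apply: contrapT => smallL.
have /choice[pi piP] (u : U * seq D) : exists d : D,
    forall b : branches D, c b = u.1 -> ~ cylinder (rcons u.2 d) b.
  apply: contrapT => nod.
  have /choice[x xP] (d : D) : exists b : branches D,
      c b = u.1 /\ cylinder (rcons u.2 d) b.
    apply: contrapT => nob; apply: nod; exists d => b cb bd.
    by apply: nob; exists b.
  apply: (cH x); first by exists u.2 => // d; have [] := xP d.
  by exists u.1 => d; have [] := xP d.
have [||x [_ xP]] := evade_predictors D _ _ (enum D) (fun u t => pi (u, t)) smallL.
- by rewrite -size_eq0 -cardE -lt0n.
- by move=> u t; rewrite mem_enum.
have [j _ xj] := xP (c (x : branches D)) (cL _) 0.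
apply: (piP (c (x : branches D), mkseq x j) x) => //=.
by rewrite /cylinder /= size_rcons size_mkseq mkseqS xj.
Qed.

Theorem theorem6p10 (Gamma : topologicalType -> Prop) (D : finType)
    (D_ge2 : (2 <= #|D|)%N) (ogd : @OGD D Gamma)
    (X : topologicalType) (X_hausdorff : hausdorff_space X) (X_Gamma : Gamma X)
    (H : set ({ptws D -> X})) (H_dihypergraph : @dihypergraph D X H)
    (H_open : open H) :
  (chromatic H #<= [set: nat]) \/ (bounding #<= chromatic H).
Proof.
have [?|[phi [_ phiH]]] :=
  ogd X X_Gamma H H_dihypergraph (ptws_open_box_open D X H H_open); first by left.
right; apply: bounding_le_H_branches_coloring (ltnW D_ge2) _.
have [c [cL cH]] := chromatic_colorable H_dihypergraph.
by exists (c \o phi); split=> [b|x /phiH /cH]; [exact: cL|].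
Qed.
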